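(* Let $M$ be a manifold, let $0\leq k\leq\ell<\infty$, and let $(x_1,\ldots,x_k)\in\mathrm{Conf}_k(M)$. The square $$\begin{array}{ccc}\mathrm{Conf}_{\ell-k}(M\setminus\{x_1,\ldots,x_k\})&\to&\mathrm{Conf}_\ell(M)\\ \downarrow&&\downarrow\\ \{(x_1,\ldots,x_k)\}&\to&\mathrm{Conf}_k(M)\end{array}$$ is homotopy Cartesian, where the right-hand vertical map is the projection $(y_1,\ldots,y_\ell)\mapsto(y_1,\ldots,y_k)$ onto the first $k$ coordinates and the top horizontal map is the inclusion $(y_{k+1},\ldots,y_\ell)\mapsto(x_1,\ldots,x_k,y_{k+1},\ldots,y_\ell)$ of the fibre over $(x_1,\ldots,x_k)$.
   Context: Manifolds are smooth, without boundary, and of finite type. $\mathrm{Conf}_k(M)=\{(y_1,\ldots,y_k)\in M^k:y_i\neq y_j\text{ if }i\neq j\}$ with the subspace topology. The homotopy fibre of a map $f:A\to B$ over $b\in B$ is the space of pairs $(a,\gamma)$ with $a\in A$ and $\gamma$ a path in $B$ from $f(a)$ to $b$. A commuting square is homotopy Cartesian if the induced map on homotopy fibres of its vertical maps is a weak homotopy equivalence; here this means that the natural map from the fibre $\mathrm{Conf}_{\ell-k}(M\setminus\{x_1,\ldots,x_k\})$ to the homotopy fibre of the projection over $(x_1,\ldots,x_k)$ is a weak homotopy equivalence. *)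

(* Defs.v *)
From HB Require Import structures.
From mathcomp Require Import all_boot all_order all_algebra.
From mathcomp Require Import all_classical all_reals all_analysis.

Set Implicit Arguments.
Unset Strict Implicit.
Unset Printing Implicit Defensive.

Import Order.TTheory GRing.Theory Num.Theory.
Import numFieldNormedType.Exports.

Local Open Scope classical_set_scope.
Local Open Scope ring_scope.

(* A set used as a type is a [set_type]: it carries the subspace topology. *)

Section SmoothManifolds.
Context {R : realType}.

(* [f] is of class C^r on the open set [V]: its iterated partial derivatives
   of order at most [r] exist and are continuous on [V]. The values of [f]
   outside [V] are irrelevant because [V] is open. *)
Fixpoint of_class (n m r : nat) (V : set 'rV[R]_n)
    (f : 'rV[R]_n -> 'rV[R]_m) : Prop :=
  (forall v, V v -> {for v, continuous f}) /\
  if r is r'.+1 then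
    forall i : 'I_n,
      (forall v, V v -> derivable f v (delta_mx ord0 i)) /\
      of_class r' V (fun v => 'D_(delta_mx ord0 i) f v)
  else True.

Definition smooth_on (n m : nat) (V : set 'rV[R]_n)
    (f : 'rV[R]_n -> 'rV[R]_m) : Prop :=
  forall r, of_class r V f.

(* [chart_map] and [chart_inv] are total functions that are meaningful only on
   [chart_dom] and on its image respectively. *)
Record chart (n : nat) (M : topologicalType) := Chart {
  chart_dom : set M;
  chart_map : M -> 'rV[R]_n;
  chart_inv : 'rV[R]_n -> M;
  chart_dom_open : open chart_dom;
  chart_img_open : open (chart_map @` chart_dom);
  chart_mapK : forall p, chart_dom p -> chart_inv (chart_map p) = p;
  chart_map_cont : {within chart_dom, continuous chart_map};
  chart_inv_cont : {within chart_map @` chart_dom, continuous chart_inv}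
}.

Definition smooth_transition (n : nat) (M : topologicalType)
    (c d : chart n M) : Prop :=
  smooth_on (chart_map c @` (chart_dom c `&` chart_dom d))
            (chart_map d \o chart_inv c).

Record smooth_manifold (n : nat) (M : topologicalType)
    (A : set (chart n M)) : Prop := SmoothManifold {
  manifold_hausdorff : hausdorff_space M;
  manifold_second_countable : @second_countable M;
  atlas_cover : forall p, exists2 c, A c & chart_dom c p;
  atlas_smooth : forall c d, A c -> A d -> smooth_transition c d
}.

(* A diffeomorphism from the open submanifold [U] onto R^n is the same thing as
   a chart with domain [U] and image R^n compatible with the atlas. *)
Definition diffeomorphic_to_Rn (n : nat) (M : topologicalType)
    (A : set (chart n M)) (U : set M) : Prop :=
  exists c : chart n M,
    [/\ chart_dom c = U,
        chart_map c @` U = setT &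
        forall d, A d -> smooth_transition c d /\ smooth_transition d c].

(* Finite type in the sense of Bott and Tu: there is a finite good cover. *)
Definition finite_type (n : nat) (M : topologicalType)
    (A : set (chart n M)) : Prop :=
  exists B : set (set M),
    [/\ finite_set B,
        (forall U, B U -> open U),
        \bigcup_(U in B) U = setT &
        forall C : set (set M), C `<=` B -> C !=set0 ->
          \bigcap_(U in C) U !=set0 ->
          diffeomorphic_to_Rn A (\bigcap_(U in C) U)].

End SmoothManifolds.

Section HomotopyTheory.
Context {R : realType}.

Local Notation I := (set_type `[0%R, 1%R : R]).

(* The endpoints of [I] are the [t] with [set_val t = 0], resp. [1]. *)

Definition path_class {X : topologicalType} (x : X) : set X :=
  [set y | exists g : I -> X,
    [/\ continuous g, forall t, set_val t = 0 -> g t = x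
                    & forall t, set_val t = 1 -> g t = y]].

Definition pi0 (X : topologicalType) : set (set X) := range (@path_class X).
Arguments pi0 X : clear implicits.

Definition pi0_map {X Y : topologicalType} (f : X -> Y) (C : set X) : set Y :=
  \bigcup_(x in C) path_class (f x).

Definition cube (n : nat) : topologicalType := {ptws 'I_n -> I}.

Definition cube_boundary (n : nat) : set (cube n) :=
  [set s | exists i, set_val (s i) = 0 \/ set_val (s i) = 1].

Definition sphere_map (n : nat) {X : topologicalType} (x : X)
    : set (cube n -> X) :=
  [set a | continuous a /\ forall s, cube_boundary s -> a s = x].

Definition sphere_class (n : nat) {X : topologicalType} (x : X)
    (a : cube n -> X) : set (cube n -> X) :=
  [set b | sphere_map x b /\
    exists H : cube n * I -> X,
      [/\ continuous H,
          forall s t, set_val t = 0 -> H (s, t) = a s,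
          forall s t, set_val t = 1 -> H (s, t) = b s &
          forall s t, cube_boundary s -> H (s, t) = x]].

(* The underlying set of the n-th homotopy group. *)
Definition pi_ (n : nat) {X : topologicalType} (x : X)
    : set (set (cube n -> X)) :=
  [set sphere_class x a | a in sphere_map x].
Arguments pi_ n {X} x.

Definition pi_map (n : nat) {X Y : topologicalType} (f : X -> Y) (x : X)
    (C : set (cube n -> X)) : set (cube n -> Y) :=
  \bigcup_(a in C) sphere_class (f x) (f \o a).
Arguments pi_map n {X Y} f x C.

(* The maps induced on the groups [pi_ n.+1] are homomorphisms for any
   continuous [f], so that they are isomorphisms iff they are bijective. *)
Definition weak_homotopy_equivalence {X Y : topologicalType} (f : X -> Y)
    : Prop :=
  [/\ continuous f,
      set_bij (pi0 X) (pi0 Y) (pi0_map f) &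
      forall (n : nat) (x : X),
        set_bij (pi_ n.+1 x) (pi_ n.+1 (f x)) (pi_map n.+1 f x)].

Definition hofiber_set {A B : topologicalType} (p : A -> B) (b : B)
    : set (A * {compact-open, I -> B}) :=
  [set z | [/\ continuous (z.2 : I -> B),
               forall t, set_val t = 0 -> z.2 t = p z.1
             & forall t, set_val t = 1 -> z.2 t = b]].

Definition hofiber {A B : topologicalType} (p : A -> B) (b : B)
    : topologicalType :=
  set_type (hofiber_set p b).

(* For a commuting square, the map (a, gamma) |-> (top a, bottom o gamma) from
   the homotopy fibre of [left] over [b] to that of [right] over [bottom b]. *)
Section Square.
Context {A A' B B' : topologicalType}.
Variables (top : A -> A') (left : A -> B) (right : A' -> B') (bottom : B -> B').
Hypothesis bottom_cont : continuous bottom.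
Hypothesis commutes : forall a, bottom (left a) = right (top a).

Lemma hofiber_map_subproof (b : B) (z : hofiber left b) :
  (top (set_val z).1, bottom \o ((set_val z).2 : I -> B))
    \in hofiber_set right (bottom b).
Proof.
apply/mem_set; have [ct z0 z1] := set_valP z; split => /=.
- by move=> t; apply: continuous_comp; [exact: ct | exact: bottom_cont].
- by move=> t t0; rewrite /= z0.
- by move=> t t1; rewrite /= z1.
Qed.

Definition hofiber_map (b : B) (z : hofiber left b)
    : hofiber right (bottom b) :=
  SigSub (hofiber_map_subproof z).
End Square.

Definition homotopy_cartesian {A A' B B' : topologicalType}
    (top : A -> A') (left : A -> B) (right : A' -> B') (bottom : B -> B')
    : Prop :=
  [/\ continuous top, continuous left, continuous right &
      exists (bottom_cont : continuous bottom)
             (commutes : forall a, bottom (left a) = right (top a)),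
        forall b : B,
          weak_homotopy_equivalence
            (hofiber_map bottom_cont commutes (b := b))].

End HomotopyTheory.

Arguments path_class R {X} x.
Arguments pi0 R X : clear implicits.
Arguments cube R n : clear implicits.
Arguments weak_homotopy_equivalence R {X Y} f.
Arguments hofiber R {A B} p b.
Arguments homotopy_cartesian R {A A' B B'} top left right bottom.

Section Configurations.
Context {M : topologicalType}.

Definition Conf_set (k : nat) : set {ptws 'I_k -> M} :=
  [set y | injective (y : 'I_k -> M)].
Arguments Conf_set k : clear implicits.

Definition Conf (k : nat) : topologicalType := set_type (Conf_set k).

Definition Conf_point (k : nat) (x : Conf k) : 'I_k -> M := set_val x.

Lemma Conf_inj (k : nat) (x : Conf k) : injective (Conf_point x).
Proof. exact: (set_valP x). Qed.

Definition mkConf (k : nat) (y : 'I_k -> M) (y_inj : injective y) : Conf k :=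
  SigSub (mem_set (y_inj : Conf_set k y)).

Lemma Conf_proj_subproof (k l : nat) (kl : (k <= l)%N) (y : Conf l) :
  injective (fun i => Conf_point y (widen_ord kl i)).
Proof. by move=> i j /Conf_inj /(congr1 val) /= ij; exact: val_inj. Qed.

Definition Conf_proj (k l : nat) (kl : (k <= l)%N) (y : Conf l) : Conf k :=
  mkConf (@Conf_proj_subproof k l kl y).

Definition punctured (k : nat) (x : Conf k) : topologicalType :=
  set_type (~` range (Conf_point x)).

End Configurations.

Arguments Conf M k : clear implicits.

Section FiberInclusion.
Context {M : topologicalType}.
Variables (k l : nat) (kl : (k <= l)%N) (x : Conf M k).

(* The tuple (x_1, .., x_k, z_1, .., z_(l - k)). *)
Definition fiber_incl_fun (z : Conf (punctured x) (l - k)) (i : 'I_l) : M :=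
  match fintype.split (cast_ord (esym (subnKC kl)) i) with
  | inl j => Conf_point x j
  | inr j => set_val (Conf_point z j)
  end.

Lemma fiber_incl_subproof (z : Conf (punctured x) (l - k)) :
  injective (fiber_incl_fun z).
Proof.
have avoid a b : Conf_point x a <> set_val (Conf_point z b).
  by move=> ab; apply: (set_valP (Conf_point z b)); exists a.
move=> i j; rewrite /fiber_incl_fun => eij.
apply: (@cast_ord_inj _ _ (esym (subnKC kl))).
rewrite -[LHS]splitK -[RHS]splitK; congr unsplit; move: eij.
case: (fintype.split _) => a; case: (fintype.split _) => b.
- by move=> /Conf_inj ->.
- by move=> /avoid.
- by move=> /esym /avoid.
- by move=> /val_inj ab; rewrite (@Conf_inj (punctured x) _ z _ _ ab).
Qed.

Definition fiber_incl (z : Conf (punctured x) (l - k)) : Conf M l :=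
  mkConf (@fiber_incl_subproof z).

Definition fiber_base (z : Conf (punctured x) (l - k)) : [set x] :=
  SigSub (mem_set (erefl : [set x] x)).

End FiberInclusion.

Arguments fiber_incl {M k l} kl x z.
Arguments fiber_base {M k} l x z.

(* Main.v *)
(* The projection of configuration spaces need not be treated as a fibre bundle:
   it is enough to transport configurations locally. In a chart, the map
   v |-> v + mu(v) (a' - a), with mu a Lipschitz bump equal to 1 near a, is
   injective for a' close to a, moves a to a' and is the identity far from a.
   Composing such maps around the k points gives, for b and b' in a small open
   set U of Conf_k(M), injections T(b, b', -) of M that take b_i to b'_i, depend
   continuously on (b, b') and satisfy T(b, b, -) = id. Applying T(b, b', -) to
   all points of a configuration over b moves it to one over b'.

   A family of paths indexed by a compact X is lifted by transporting along it
   for short times; over an interval of times so short that finitely many U's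
   suffice, bump functions on X allow one to advance over one open set of X at a
   time. As T(b, b, -) = id, constant paths lift to constant paths. Hence a
   family in the homotopy fibre deforms into the fibre, and the deformation does
   not move the members that are already there; for X a cube or a cube times an
   interval this gives surjectivity and injectivity on homotopy groups. *)
Require Import Defs.
From HB Require Import structures.
From mathcomp Require Import all_boot all_order all_algebra.
From mathcomp Require Import all_classical all_reals all_analysis.
From mathcomp Require Import finmap ring lra.

Set Implicit Arguments.
Unset Strict Implicit.
Unset Printing Implicit Defensive.

Import Order.TTheory GRing.Theory Num.Theory.
Import numFieldNormedType.Exports.

Local Open Scope classical_set_scope.
Local Open Scope ring_scope.

(** * Continuity of maps defined locally or by pasting *)

Lemma continuous_pair_at (T U V : topologicalType) (f : T -> U) (g : T -> V)
    (x : T) :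
  {for x, continuous f} -> {for x, continuous g} ->
  {for x, continuous (fun y => (f y, g y))}.
Proof. by move=> cf cg; exact: cvg_pair. Qed.

Lemma near_eq_continuous_at (T U : topologicalType) (f g : T -> U) (x : T) :
  (\forall y \near x, f y = g y) ->
  {for x, continuous g} -> {for x, continuous f}.
Proof.
move=> fg cg; rewrite /prop_for /continuous_at (nbhs_singleton fg).
by apply: cvg_trans cg; apply: near_eq_cvg; apply: filterS fg => y ->.
Qed.

Lemma eq_continuous_at (T U : topologicalType) (f g : T -> U) (x : T) :
  f =1 g -> {for x, continuous g} -> {for x, continuous f}.
Proof. by move=> /funext ->. Qed.

(** The pasting lemma for the two closed sets cut out by [u <= v] and [v <= u]. It serves to
    concatenate lifts and homotopies. *)
Lemma continuous_if_le (R : realType) (T U : topologicalType) (u v : T -> R)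
    (f g : T -> U) :
  continuous u -> continuous v -> continuous f -> continuous g ->
  (forall x, u x = v x -> f x = g x) ->
  continuous (fun x => if u x <= v x then f x else g x).
Proof.
move=> cu cv cf cg fg; apply/continuous_subspace_setT.
have -> : [set: T] = [set x | u x <= v x] `|` [set x | v x <= u x].
  apply/seteqP; split=> // x _ /=.
  by case: (leP (u x) (v x)) => [|/ltW]; [left|right].
have cl (a b : T -> R) : continuous a -> continuous b ->
    closed [set x | a x <= b x].
  move=> ca cb.
  have -> : [set x | a x <= b x] = (a \- b) @^-1` [set y | y <= 0].
    by apply/seteqP; split=> x /=; rewrite subr_le0.
  apply: preimage_closed; last exact: closed_le.
  by move=> x _; apply: continuousB; [exact: ca|exact: cb].
apply: withinU_continuous; [exact: cl|exact: cl| |].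
- apply: (@subspace_eq_continuous _ _ _ f); last exact: continuous_subspaceT.
  by move=> x /set_mem /= uv; rewrite /from_subspace uv.
- apply: (@subspace_eq_continuous _ _ _ g); last exact: continuous_subspaceT.
  move=> x /set_mem /= vu; rewrite /from_subspace; case: ifP => // uv.
  by apply: esym; apply: fg; apply/eqP; rewrite eq_le uv vu.
Qed.

(** * Truncation and finite families of bump functions *)

Section Clamp.
Context {R : realType}.

Definition clamp (a b t : R) : R := Num.min b (Num.max a t).

Lemma clamp_continuous (T : topologicalType) (a b t : T -> R) (x : T) :
  {for x, continuous a} -> {for x, continuous b} -> {for x, continuous t} ->
  {for x, continuous (fun y => clamp (a y) (b y) (t y))}.
Proof.
move=> ca cb ct; apply: (@continuous_min _ _ b); first exact: cb.
by apply: (@continuous_max _ _ a t).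
Qed.

Lemma clamp_itv (a b t : R) : a <= b -> a <= clamp a b t <= b.
Proof. by move=> ab; rewrite le_min ab le_max lexx /= ge_min lexx. Qed.

Lemma clamp_id (a b t : R) : a <= t -> t <= b -> clamp a b t = t.
Proof. by move=> at_ tb; rewrite /clamp max_r// min_r. Qed.

Lemma clamp_l (a b t : R) : a <= b -> t <= a -> clamp a b t = a.
Proof. by move=> ab ta; rewrite /clamp max_l// min_r. Qed.

Lemma clamp_r (a b t : R) : a <= b -> b <= t -> clamp a b t = b.
Proof. by move=> ab bt; rewrite /clamp max_r ?min_l// (le_trans ab). Qed.

End Clamp.

(** A partition of unity without normalisation: a sum that is at least 1 is enough, because it is
    later truncated at 1. Complete regularity gives a bump around each point, compactness selects
    finitely many. The closed set [C] is kept explicit so that maps can be glued along the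
    complement of the support. *)
Lemma finite_bumps (R : realType) (X : topologicalType)
    (X_compact : compact [set: X]) (X_cr : @completely_regular_space X)
    (W : X -> set X) (W_open : forall s, open (W s)) (Ws : forall s, W s s) :
  exists (r : seq X) (lam : X -> X -> R),
    [/\ forall s, continuous (lam s), forall s x, 0 <= lam s x,
        forall s, exists2 C, closed C /\ C `<=` W s &
          forall x, ~ C x -> lam s x = 0
      & forall x, 1 <= \sum_(s <- r) lam s x].
Proof.
have /choice[lam lamP] : forall s, exists l : X -> R,
    [/\ continuous l, forall x, 0 <= l x,
      exists2 C, closed C /\ C `<=` W s & forall x, ~ C x -> l x = 0
    & exists2 N, open N /\ N s & forall x, N x -> 1 <= l x].
  move=> s.
  have : uniform_separator [set s] (~` W s).
    by apply: X_cr; [exact: open_closedC|move=> /(_ (Ws s))].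
  move=> /(@uniform_separatorP _ R)[f [cf f01 f0 f1]].
  have fs : f s = 0 by have := f0 (f s); apply; exists s.
  (* The separating function [f] is 0 at [s] and 1 off [W s]. The bump is 1 where [f <= 1/3] and 0
     where [f >= 2/3], so it is 1 near [s] and vanishes off a closed subset of [W s]. *)
  exists (fun x => clamp 0 1 (2 - 3 * f x)); split.
  - move=> x.
    apply: (@clamp_continuous _ _ (fun=> 0) (fun=> 1) (fun y => 2 - 3 * f y));
      [exact: cvg_cst|exact: cvg_cst|].
    apply: continuousB; first exact: cvg_cst.
    by apply: continuousM; [exact: cvg_cst|exact: cf].
  - by move=> x; have /andP[] := clamp_itv (2 - 3 * f x) (@ler01 R).
  - exists [set x | f x <= 2 / 3]; first split.
    + by apply: (@preimage_closed _ _ f [set y | y <= 2 / 3]);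
        [move=> ? _; exact: cf|exact: closed_le].
    + move=> x /= fx; apply: contrapT => nW.
      have : f x = 1 by apply: f1; exists x.
      lra.
    + by move=> x /= /negP; rewrite -ltNge => fx; rewrite clamp_l//; lra.
  - exists [set x | f x < 1 / 3]; first split.
    + by apply: (@open_comp _ _ f [set y | y < 1 / 3]);
        [move=> ? _; exact: cf|exact: open_lt].
    + by rewrite /= fs; lra.
    + by move=> x /= fx; rewrite clamp_r//; lra.
have lam_ge0 s x : 0 <= lam s x by have [] := lamP s.
have /choice[N NP] : forall s, exists N : set X,
    [/\ open N, N s & forall x, N x -> 1 <= lam s x].
  by move=> s; have [_ _ _ [N [? ?] ?]] := lamP s; exists N.
(* Compactness by covers is applied to a pointed space; an empty [X] is dealt with by the empty
   list. *)
have [x0|X0] := pselect (exists x : X, True); last first.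
  exists [::], lam; split => //; first by move=> s; have [] := lamP s.
    by move=> s; have [] := lamP s.
  by move=> x; case: X0; exists x.
case: x0 => x0 _.
pose Xp : ptopologicalType := HB.pack (X : Type) (Topological.class X)
  (isPointed.Build X x0).
have : @cover_compact Xp [set: Xp] by rewrite -compact_cover; exact: X_compact.
move=> /(_ X [set: X] N)[].
- by move=> s _; have [] := NP s.
- by move=> x _; exists x => //; have [] := NP x.
move=> D _ Dcov; exists (enum_fset D), lam; split => //.
- by move=> s; have [] := lamP s.
- by move=> s; have [] := lamP s.
move=> x; have [s /= sD Nsx] := Dcov x I.
rewrite (big_rem s)//=; apply: (@le_trans _ _ (lam s x)).
  by have [_ _ ->] := NP s.
by rewrite lerDl; apply: sumr_ge0.
Qed.

(** * Path lifting *)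

(** A weak substitute for local triviality: [tau (-, b)] moves a point to the fibre over [b], but is
    not asked to be a bijection between fibres. [tau] is total and meaningful only over [U]. The
    last clause is what keeps constant paths from moving anything. *)
Definition local_transport (E B : topologicalType) (p : E -> B) : Prop :=
  forall b0 : B, exists (U : set B) (tau : E * B -> E),
    [/\ open U, U b0,
        forall e b, U (p e) -> U b -> {for (e, b), continuous tau},
        forall e b, U (p e) -> U b -> p (tau (e, b)) = b
      & forall e, U (p e) -> tau (e, p e) = e].

Section Lifting.
Context {R : realType} {X E B : topologicalType}.
Variables (p : E -> B) (gamma : X * R -> B).
Hypothesis gamma_cont : continuous gamma.
Hypothesis p_transport : local_transport p.

(* The last clause makes the lift stationary wherever the path is; this is what
   yields homotopies relative to the boundary of a cube. *)
Definition lifts (th th' : X -> R) : Prop :=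
  forall g : X -> E, continuous g -> (forall s, p (g s) = gamma (s, th s)) ->
  exists G : X * R -> E,
    [/\ continuous G,
        forall s, G (s, th s) = g s,
        forall s t, th s <= t -> t <= th' s -> p (G (s, t)) = gamma (s, t)
      & forall s, (forall t, gamma (s, t) = gamma (s, th s)) ->
        forall t, G (s, t) = g s].

Lemma lifts_refl (th : X -> R) : lifts th th.
Proof.
move=> g cg pg; exists (g \o fst); split => //.
- by move=> x; apply: continuous_comp; [exact: cvg_fst|exact: cg].
- by move=> s t th1 th2; rewrite /= pg; congr (gamma (_, _)); apply: le_anti;
    rewrite th1 th2.
Qed.

(** The second lift starts at the end of the first, and the two are pasted along the graph of
    [th2]. *)
Lemma lifts_trans (th1 th2 th3 : X -> R) :
  continuous th2 -> (forall s, th1 s <= th2 s) ->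
  lifts th1 th2 -> lifts th2 th3 -> lifts th1 th3.
Proof.
move=> c2 th12 L12 L23 g cg pg.
have [G [cG Gth1 pG Greg]] := L12 g cg pg.
have [|s|G' [cG' G'th2 pG' G'reg]] := L23 (fun s => G (s, th2 s)).
- move=> s; apply: (@continuous_comp _ _ _ (fun s => (s, th2 s)) G).
    by apply: continuous_pair_at => //; exact: c2.
  exact: cG.
- exact: pG.
exists (fun st => if st.2 <= th2 st.1 then G st else G' st); split.
- apply: (@continuous_if_le R _ _ snd (th2 \o fst)) => //.
  + by move=> ?; exact: cvg_snd.
  + by move=> ?; apply: continuous_comp; [exact: cvg_fst|exact: c2].
  + by move=> [s t] /= ->; rewrite G'th2.
- by move=> s /=; rewrite th12.
- move=> s t /= t1 t3; case: ifP => t2; first exact: pG.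
  by apply: pG' => //; rewrite ltW// ltNge t2.
- move=> s Hs t /=; case: ifP => t2; first exact: Greg.
  rewrite G'reg; first exact: Greg.
  by move=> t'; rewrite Hs (Hs (th2 s)).
Qed.

(** Over [W] the relevant piece of path stays in [U], so one application of [tau] lifts it. Off [C]
    this piece is a single point and the transport is the identity; hence the lift extends by [g]
    across the boundary of [W]. *)
Lemma lifts_supported (U : set B) (tau : E * B -> E) (W C : set X)
    (th th' : X -> R) :
  (forall e b, U (p e) -> U b -> {for (e, b), continuous tau}) ->
  (forall e b, U (p e) -> U b -> p (tau (e, b)) = b) ->
  (forall e, U (p e) -> tau (e, p e) = e) ->
  open W -> closed C -> C `<=` W ->
  continuous th -> continuous th' ->
  (forall s, th s <= th' s) -> (forall s, ~ C s -> th' s = th s) ->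
  (forall s t, W s -> th s <= t -> t <= th' s -> U (gamma (s, t))) ->
  lifts th th'.
Proof.
move=> ctau ptau tauid oW clC CW cth cth' thth' thC WU g cg pg.
(* Clamping the time makes the lift defined for all real [t] and constant outside the interval from
   [th s] to [th' s]. *)
pose c (st : X * R) := clamp (th st.1) (th' st.1) st.2.
have cc : continuous c.
  move=> st; apply: (@clamp_continuous _ _ (th \o fst) (th' \o fst) snd).
  - by apply: continuous_comp; [exact: cvg_fst|exact: cth].
  - by apply: continuous_comp; [exact: cvg_fst|exact: cth'].
  - exact: cvg_snd.
have cU s t : W s -> U (gamma (s, c (s, t))).
  by move=> Ws; have /andP[? ?] := clamp_itv t (thth' s); exact: WU.
have gU s : W s -> U (p (g s)).
  by move=> Ws; rewrite pg; apply: WU.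
pose H st := tau (g st.1, gamma (st.1, c st)).
have Hstat s t : W s -> gamma (s, c (s, t)) = gamma (s, th s) ->
    H (s, t) = g s.
  by move=> Ws e; rewrite /H /= e -pg tauid//; exact: gU.
have HC s t : W s -> ~ C s -> H (s, t) = g s.
  move=> Ws nC; apply: Hstat => //.
  have /andP[] := clamp_itv t (thth' s); rewrite /c/= thC// => h1 h2.
  by congr (gamma (_, _)); apply: le_anti; rewrite h1 h2.
exists (fun st => if `[< W st.1 >] then H st else g st.1); split.
- move=> [s t]; have [Ws|nWs] := pselect (W s).
    apply: (@near_eq_continuous_at _ _ _ H).
      exists (W, setT); first by split; [exact: open_nbhs_nbhs|exact: filterT].
      by move=> [a b] [/= Wa _]; rewrite asboolT.
    apply: (@continuous_comp _ _ _
      (fun st => (g st.1, gamma (st.1, c st))) tau).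
      apply: continuous_pair_at.
        by apply: (@continuous_comp _ _ _ fst g); [exact: cvg_fst|exact: cg].
      apply: (@continuous_comp _ _ _ (fun st => (st.1, c st)) gamma).
        by apply: continuous_pair_at; [exact: cvg_fst|exact: cc].
      exact: gamma_cont.
    by apply: ctau; [exact: gU|exact: cU].
  (* A point outside [W] is outside [C], and on the open complement of [C] both branches equal
     [g]. *)
  apply: (@near_eq_continuous_at _ _ _ (g \o fst)).
    exists (~` C, setT).
      split; last exact: filterT.
      apply: open_nbhs_nbhs; split; first exact: closed_openC.
      by move=> /CW.
    move=> [a b] [/= nCa _]; case: asboolP => // Wa; exact: HC.
  by apply: continuous_comp; [exact: cvg_fst|exact: cg].
- move=> s /=; case: asboolP => // Ws; apply: Hstat => //.
  by rewrite /c /= clamp_l.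
- move=> s t t1 t2 /=; case: asboolP => [Ws|nWs].
    rewrite /H ptau /=; [|exact: gU|exact: cU].
    by rewrite /c clamp_id.
  rewrite pg; congr (gamma (_, _)); apply: le_anti.
  by rewrite t1 /= -(thC s) => [|/CW].
- move=> s Hs t /=; case: asboolP => // Ws; exact: Hstat.
Qed.

(** By continuity at [(s, t0)], a product of a neighbourhood of [s] and an interval around [t0] is
    sent into one [U]. *)
Lemma lifts_near (s : X) (t0 : R) : exists (W : set X) (eps : R),
  [/\ open W, W s, 0 < eps &
    forall (C : set X) (th th' : X -> R),
      closed C -> C `<=` W -> continuous th -> continuous th' ->
      (forall x, t0 - eps < th x) -> (forall x, th' x < t0 + eps) ->
      (forall x, th x <= th' x) -> (forall x, ~ C x -> th' x = th x) ->
      lifts th th'].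
Proof.
have [U [tau [oU Us ctau ptau tauid]]] := p_transport (gamma (s, t0)).
have : nbhs (s, t0) (gamma @^-1` U).
  by apply: gamma_cont; exact: open_nbhs_nbhs.
move=> [[W J] /= [Ws Jt] WJ].
have /nbhs_ballP[eps /= eps0 epsJ] := Jt.
exists (interior W), eps; split => //.
- exact: open_interior.
- move=> C th th' clC CW cth cth' th1 th2 thth' thC.
  apply: (@lifts_supported U tau (interior W) C) => //.
    exact: open_interior.
  move=> x t /interior_subset Wx t1 t2; apply: (WJ (x, t)); split => //.
  apply: epsJ; rewrite /ball /= ltr_distlC.
  by rewrite (lt_le_trans (th1 x))//= (le_lt_trans t2).
Qed.

Hypothesis X_compact : compact [set: X].
Hypothesis X_cr : @completely_regular_space X.

(** The intermediate times are functions on [X]: they grow with the partial sums of the bumps, and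
    passing from one to the next changes the time only on the support of a single bump. *)
Lemma lifts_short (t0 : R) : exists2 eps : R, 0 < eps &
  forall a b : R, t0 - eps < a -> a <= b -> b < t0 + eps ->
    lifts (fun=> a) (fun=> b).
Proof.
have /choice[W WP] := fun s => lifts_near s t0.
have /choice[eps epsP] := WP.
have [|s|r [lam [clam lam0 lamC lam1]]] := @finite_bumps R X X_compact X_cr W.
- by move=> s; have [] := epsP s.
- by have [] := epsP s.
have [e e0 er] : exists2 e : R, 0 < e & forall s, s \in r -> e <= eps s.
  elim: {lam1} r => [|s r [e e0 er]]; first by exists 1.
  exists (Num.min e (eps s)).
    by rewrite lt_min e0; have [] := epsP s.
  move=> x; rewrite inE => /orP[/eqP ->|/er ex].
    by rewrite ge_min lexx orbT.
  by rewrite ge_min ex.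
exists e => // a b ta ab tb.
(* The time is [a] for the empty sum and, thanks to the truncation at 1, exactly [b] for the full
   one. *)
pose h (sg : X -> R) x := a + (b - a) * Num.min 1 (sg x).
have ch sg : continuous sg -> continuous (h sg).
  move=> csg x.
  apply: (@continuousD _ _ _ (fun=> a) (fun y => (b - a) * Num.min 1 (sg y)) x).
    exact: cvg_cst.
  apply: (@continuousM _ _ (fun=> b - a) (fun y => Num.min 1 (sg y)) x).
    exact: cvg_cst.
  by apply: (@continuous_min _ _ (fun=> 1)); [exact: cvg_cst|exact: csg].
have hab sg x : 0 <= sg x -> a <= h sg x <= b.
  move=> sg0; rewrite /h.
  have m0 : 0 <= Num.min 1 (sg x) by rewrite le_min ler01.
  have m1 : Num.min 1 (sg x) <= 1 by rewrite ge_min lexx.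
  by apply/andP; split; nra.
have hmono sg sg' x : sg x <= sg' x -> h sg x <= h sg' x.
  move=> ss; rewrite lerD2l ler_wpM2l ?subr_ge0//.
  by rewrite le_min ge_min lexx /= ge_min ss orbT.
(* The sum [sg] of the bumps already used is a parameter of the induction on those that remain. *)
have step : forall r' : seq X, (forall s, s \in r' -> s \in r) ->
    forall sg : X -> R, continuous sg -> (forall x, 0 <= sg x) ->
    lifts (h sg) (h (fun x => sg x + \sum_(s <- r') lam s x)).
  elim=> [|s r' IH] r'r sg csg sg0.
    have -> : (fun x => sg x + \sum_(s <- [::]) lam s x) = sg.
      by apply/funext => x; rewrite big_nil addr0.
    exact: lifts_refl.
  pose sg' x := sg x + lam s x.
  have csg' : continuous sg'.
    by move=> x; apply: (@continuousD _ _ _ sg (lam s) x); [exact: csg|exact: clam].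
  have sg'0 x : 0 <= sg' x by apply: addr_ge0.
  have -> : (fun x => sg x + \sum_(s0 <- s :: r') lam s0 x) =
      (fun x => sg' x + \sum_(s0 <- r') lam s0 x).
    by apply/funext => x; rewrite big_cons addrA.
  have sgsg' x : h sg x <= h sg' x by apply: hmono; rewrite lerDl.
  apply: (@lifts_trans _ (h sg')) => //; first exact: ch.
    have [C [clC CW] Cl] := lamC s.
    have [_ _ _] := epsP s; apply; [exact: clC|exact: CW|exact: ch|exact: ch| | | |].
    - move=> x; have /andP[ah _] := hab _ _ (sg0 x).
      by have := er s (r'r s (mem_head _ _)); lra.
    - move=> x; have /andP[_ hb] := hab _ _ (sg'0 x).
      by have := er s (r'r s (mem_head _ _)); lra.
    - exact: sgsg'.
    - by move=> x nC; rewrite /h /sg' Cl// addr0.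
  by apply: IH => // x xr'; apply: r'r; rewrite inE xr' orbT.
have c0 : continuous ((fun=> 0) : X -> R) by move=> x; exact: cvg_cst.
have := step r (fun _ => id) (fun=> 0) c0 (fun=> lexx 0).
have -> : h (fun=> 0) = fun=> a.
  by apply/funext => x; rewrite /h min_r ?ler01// mulr0 addr0.
have -> : h (fun x => 0 + \sum_(s <- r) lam s x) = fun=> b.
  by apply/funext => x; rewrite /h add0r min_l// mulr1 addrC subrK.
exact.
Qed.

(** Let [c] be the supremum of the times up to which lifting from 0 is possible. A short interval
    around [c] contains such a time and allows one to go on beyond [c]. *)
Lemma lifts01 : lifts (fun=> 0) (fun=> 1).
Proof.
pose S := [set t : R | [/\ 0 <= t, t <= 1 & lifts (fun=> 0) (fun=> t)]].
have S0 : S 0 by split; [|exact: ler01|exact: lifts_refl].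
have S_sup : has_sup S.
  by split; [exists 0|exists 1 => t []].
have ub := sup_upper_bound S_sup.
set c := sup S in ub *.
have c1 : c <= 1 by apply: ge_sup; [exists 0|move=> t []].
have c0 : 0 <= c by exact: ub.
have [eps eps0 short] := lifts_short c.
have [t [t0 t1 Lt] ct] := sup_adherent eps0 S_sup.
have tc : t <= c by apply: ub.
have ext d : c <= d -> d < c + eps -> lifts (fun=> 0) (fun=> d).
  move=> cd dc; apply: (@lifts_trans _ (fun=> t)) => //.
    by move=> ?; exact: cvg_cst.
  by apply: short => //; exact: le_trans cd.
(* Either 1 is within reach from [c], or [c + eps / 2] belongs to [S] and exceeds its supremum. *)
have [/ext|] := ltP 1 (c + eps); first exact.
move=> c1'; have /ub : S (c + eps / 2).
  by split; [lra|lra|apply: ext; lra].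
lra.
Qed.

End Lifting.

(** * Local transport of configurations *)

Section SubspaceProduct.
Context {X T : topologicalType}.

Lemma continuous_set_type_at (A : set T) (f : X -> set_type A) (x : X) :
  {for x, continuous (fun y => set_val (f y))} -> {for x, continuous f}.
Proof.
move=> cf N [? [[W oW <-] Wfx]] /filterS; apply; apply: cf.
exact: open_nbhs_nbhs.
Qed.

Lemma continuous_ptws_at (J : Type) (f : X -> {ptws J -> T}) (x : X) :
  (forall j, {for x, continuous (fun y => f y j)}) -> {for x, continuous f}.
Proof.
move=> cf; apply/cvg_sup => j; apply/cvg_image.
  by apply/seteqP; split => // t _; exists (fun=> t).
move=> N /(cf j) fN; exists [set g : J -> T | N (g j)] => //.
by apply/seteqP; split => [_ [g ? <-]//|t Nt]; exists (fun=> t).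
Qed.

End SubspaceProduct.

Lemma Conf_point_continuous (M : topologicalType) (k : nat) (i : 'I_k) :
  continuous (fun y : Conf M k => Conf_point y i).
Proof.
move=> y; apply: (@continuous_comp _ _ _ (set_val : Conf M k -> _)
  (fun f : {ptws 'I_k -> M} => f i)).
  exact: initial_continuous.
exact: (@proj_continuous _ (fun=> M) i).
Qed.

Lemma continuous_Conf_at (X M : topologicalType) (k : nat) (f : X -> Conf M k)
    (x : X) :
  (forall i, {for x, continuous (fun y => Conf_point (f y) i)}) ->
  {for x, continuous f}.
Proof.
by move=> cf; apply: continuous_set_type_at; exact: continuous_ptws_at.
Qed.

(* Pushing a to a' by injections of M that are the identity outside V. *)
Definition pushable (M : topologicalType) (m0 : M) (V : set M) : Prop :=
  exists (O : set M) (phi : M * M * M -> M),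
    [/\ [/\ open O, O m0 & O `<=` V],
        forall a a' m, O a -> O a' -> {for (a, a', m), continuous phi},
        forall a a', O a -> O a' ->
          phi (a, a', a) = a' /\ injective (fun m => phi (a, a', m)),
        forall a a' m, O a -> O a' -> ~ V m -> phi (a, a', m) = m
      & forall a m, O a -> phi (a, a, m) = m].

Definition local_push (M : topologicalType) : Prop :=
  forall (m0 : M) (V : set M), open V -> V m0 -> pushable m0 V.

Lemma clamp_lipschitz (R : realType) (x y : R) : `|clamp 0 1 x - clamp 0 1 y| <= `|x - y|.
Proof.
rewrite /clamp; have := ler_norm (x - y); have := ler_norm (y - x).
rewrite (distrC y x) ler_norml.
by case: (ltP 0 x) => ?; case: (ltP 0 y) => ?; case: (ltP 1 x) => ?;
  case: (ltP 1 y) => ?; case: (ltP 1 (0 : R)) => ? ? ?; apply/andP; split; lra.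
Qed.

(** * Pushing points in a normed space and in a chart *)

Section NormedPush.
Context {R : realType} {E : normedModType R}.
Variables (v0 : E) (r : R).
Hypothesis r0 : 0 < r.

Definition bump (v : E) : R := clamp 0 1 (2 - `|v - v0| / r).

Lemma bump_near (v : E) : `|v - v0| <= r -> bump v = 1.
Proof.
move=> vr; apply: clamp_r; first exact: ler01.
by have : `|v - v0| / r <= 1 by [rewrite ler_pdivrMr// mul1r]; lra.
Qed.

Lemma bump_far (v : E) : 2 * r <= `|v - v0| -> bump v = 0.
Proof.
move=> vr; apply: clamp_l; first exact: ler01.
by have : 2 <= `|v - v0| / r by [rewrite ler_pdivlMr]; lra.
Qed.

Lemma bump_continuous : continuous bump.
Proof.
move=> v; apply: (@clamp_continuous _ _ (fun=> 0) (fun=> 1)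
  (fun w : E => 2 - `|w - v0| / r)); [exact: cvg_cst|exact: cvg_cst|].
apply: continuousB.
  exact: cvg_cst.
apply: (@continuousM _ _ (fun w : E => `|w - v0|) (fun=> r^-1));
  last exact: cvg_cst.
apply: (@continuous_comp _ _ _ (fun w : E => w - v0) Num.norm).
  by apply: (@continuousB _ _ _ id (fun=> v0)); [exact: cvg_id|exact: cvg_cst].
exact: norm_continuous.
Qed.

Lemma bump_lipschitz (v w : E) : `|bump v - bump w| * r <= `|v - w|.
Proof.
have := clamp_lipschitz (2 - `|v - v0| / r) (2 - `|w - v0| / r).
move=> /le_trans h; rewrite -ler_pdivlMr//; apply: h.
have -> : 2 - `|v - v0| / r - (2 - `|w - v0| / r) =
  (`|w - v0| - `|v - v0|) / r by ring.
rewrite normrM normfV (gtr0_norm r0) ler_wpM2r ?invr_ge0 ?(ltW r0)//.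
rewrite (distrC v w); apply: le_trans (ler_dist_dist _ _) _.
by rewrite opprB addrA subrK.
Qed.

(** [z] is a triple (a, a', v), and v is the point being moved. The bump is centred at the fixed
    [v0] rather than at a, so that the region affected is the same for all a and a'. *)
Definition push (z : E * E * E) : E := z.2 + bump z.2 *: (z.1.2 - z.1.1).

Lemma push_continuous : continuous push.
Proof.
move=> z; apply: (@continuousD _ _ _ (fun z : E * E * E => z.2)
  (fun z : E * E * E => bump z.2 *: (z.1.2 - z.1.1))); first exact: cvg_snd.
apply: (@continuousZ _ _ _ (fun z : E * E * E => bump z.2)
  (fun z : E * E * E => z.1.2 - z.1.1)).
  by apply: (@continuous_comp _ _ _ snd bump);
    [exact: cvg_snd|exact: bump_continuous].
apply: (@continuousB _ _ _ (fun z : E * E * E => z.1.2)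
  (fun z : E * E * E => z.1.1)).
- by apply: (@continuous_comp _ _ _ fst snd); [exact: cvg_fst|exact: cvg_snd].
- by apply: (@continuous_comp _ _ _ fst fst); [exact: cvg_fst|exact: cvg_fst].
Qed.

(** A point at distance at least 2r from [v0] does not move, and any other moves by less than r. *)
Lemma push_ball (a a' v : E) : `|a' - a| < r -> `|v - v0| < 3 * r ->
  `|push (a, a', v) - v0| < 3 * r.
Proof.
move=> w ve; rewrite /push /=.
have [v2|v2] := leP (2 * r) `|v - v0|; first by rewrite bump_far// scale0r addr0.
rewrite addrAC (le_lt_trans (ler_normD _ _))// normrZ.
have /andP[b0 b1] : 0 <= bump v <= 1 by apply: clamp_itv; exact: ler01.
by rewrite (ger0_norm b0); have := normr_ge0 (a' - a); nra.
Qed.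

(* The bump is (1/r)-Lipschitz, so a translation by less than r scaled by it
   contracts strictly. *)
Lemma push_inj (a a' : E) : `|a' - a| < r -> injective (fun v => push (a, a', v)).
Proof.
rewrite /push /= => wr v w vw.
have e1 : v - w = (bump w - bump v) *: (a' - a).
  by rewrite scalerBl; apply/eqP; rewrite subr_eq addrC addrA -subr_eq opprK vw.
have := bump_lipschitz v w; rewrite e1 normrZ (distrC (bump v)) => h.
have : `|bump w - bump v| * (r - `|a' - a|) <= 0 by rewrite mulrBr; lra.
rewrite pmulr_lle0 ?subr_gt0// normr_le0 => /eqP h0.
by apply: subr0_eq; rewrite e1 h0 scale0r.
Qed.

End NormedPush.

Section ChartPush.
Context {R : realType} {n : nat} {M : topologicalType}.

(** [push] is conjugated by the chart on a small coordinate ball and extended by the identity to the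
    rest of [M]. *)
Lemma chart_push (M_hausdorff : hausdorff_space M) (c : @chart R n M) (m0 : M)
    (V : set M) : chart_dom c m0 -> open V -> V m0 ->
  pushable m0 V.
Proof.
move=> Dm0 oV Vm0.
pose D := chart_dom c; pose f := chart_map c; pose g := chart_inv c.
have oD : open D by exact: chart_dom_open.
have gK p : D p -> g (f p) = p by exact: chart_mapK.
have cf : {in D, continuous f}.
  by rewrite -continuous_open_subspace//; exact: chart_map_cont.
have cg : {in f @` D, continuous g}.
  rewrite -continuous_open_subspace; last exact: chart_img_open.
  exact: chart_inv_cont.
pose v0 := f m0.
have fD0 : (f @` D) v0 by exists m0.
have : nbhs v0 (f @` D `&` g @^-1` V).
  apply: filterI.
    by apply: open_nbhs_nbhs; split => //; exact: chart_img_open.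
  apply: (cg v0); first exact/mem_set.
  by rewrite [g v0]gK//; exact: open_nbhs_nbhs.
move=> /nbhs_ballP[e /= e0 ballV].
(* The bump lives in the ball of radius 2r, and [push] preserves the ball of radius 3r = e, which
   the inverse chart maps into [V]. *)
pose r := e / 3.
have r0 : 0 < r by rewrite /r divr_gt0.
have er : e = 3 * r by rewrite /r; lra.
have inim (v : 'rV[R]_n) : `|v - v0| < e -> D (g v) /\ f (g v) = v /\ V (g v).
  move=> ve; have [|[p Dp <-] Vg] := ballV v.
    by rewrite -ball_normE /ball_ /= distrC.
  by rewrite gK//; split => //; split => //; rewrite -[p]gK.
pose Q d := D `&` f @^-1` [set v : 'rV[R]_n | `|v - v0| < d].
have ballE d : [set v : 'rV[R]_n | `|v - v0| < d] = ball v0 d.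
  by apply/seteqP; split => v; rewrite -ball_normE /ball_ /= distrC.
have oQ d : open (Q d).
  have cf' : forall Y, open Y -> open (D `&` f @^-1` Y) by apply/continuous_inP.
  by apply: cf'; rewrite ballE; exact: ball_open.
pose psi := push v0 r.
pose phi (z : M * M * M) : M :=
  if `[< Q e z.2 >] then g (psi (f z.1.1, f z.1.2, f z.2)) else z.2.
(* Two points within r/2 of [v0] are less than r apart, as [push_ball] and [push_inj] require. They
   also lie where the bump is 1, so that [push] takes the first to the second. *)
have Ow a a' : Q (r / 2) a -> Q (r / 2) a' -> `|f a' - f a| < r.
  move=> [_ /= ha] [_ /= ha'].
  have -> : f a' - f a = (f a' - v0) - (f a - v0) by rewrite opprB addrA subrK.
  by rewrite (le_lt_trans (ler_normB _ _))//; lra.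
have psiQ a a' v : Q (r / 2) a -> Q (r / 2) a' -> `|v - v0| < e ->
    `|psi (f a, f a', v) - v0| < e.
  by move=> Oa Oa' ve; rewrite er; apply: push_ball => //; [exact: Ow|rewrite -er].
have phiQ a a' m : Q (r / 2) a -> Q (r / 2) a' -> Q e m ->
    f (phi (a, a', m)) = psi (f a, f a', f m) /\ Q e (phi (a, a', m)).
  move=> Oa Oa' Qm; rewrite /phi asboolT//=.
  have pe := psiQ _ _ _ Oa Oa' Qm.2.
  by have [Dg [fg _]] := inim _ pe; split => //; split => //=; rewrite fg.
have phiN a a' m : ~ Q e m -> phi (a, a', m) = m.
  by move=> nQ; rewrite /phi asboolF.
have QV : Q e `<=` V.
  by move=> m [Dm /= /inim [_ [_]]]; rewrite gK.
have Qsub d d' : d <= d' -> Q d `<=` Q d'.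
  by move=> dd m [Dm /= md]; split => //=; exact: lt_le_trans dd.
have r2e : r / 2 <= e by lra.
(* Closed in all of [M], not merely in the chart domain: it is the image of a compact ball, and [M]
   is Hausdorff. This makes the extension by the identity continuous. *)
have clK : closed (D `&` f @^-1` [set v : 'rV[R]_n | `|v - v0| <= 2 * r]).
  apply: compact_closed => //.
  have -> : D `&` f @^-1` [set v : 'rV[R]_n | `|v - v0| <= 2 * r] =
      g @` [set v : 'rV[R]_n | `|v - v0| <= 2 * r].
    apply/seteqP; split => [m [Dm /= mr]|_ [v /= vr <-]].
      by exists (f m) => //=; exact: gK.
    have [|Dg [fg _]] := inim v; first by rewrite (le_lt_trans vr)// er; lra.
    by split => //=; rewrite fg.
  apply: continuous_compact.
    apply: continuous_in_subspaceT => v /set_mem /= vr; apply: cg.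
    have [|Dg [fg _]] := inim v; first by rewrite (le_lt_trans vr)// er; lra.
    by apply/mem_set; exists (g v).
  have -> : [set v : 'rV[R]_n | `|v - v0| <= 2 * r] = closed_ball_ Num.norm v0 (2 * r).
    by apply/seteqP; split => v; rewrite /closed_ball_ /= distrC.
  apply: bounded_closed_compact; last exact: closed_closed_ball_.
  exists (`|v0| + 2 * r); split; first exact: num_real.
  move=> x xr v; rewrite /closed_ball_ /= => vr; apply: ltW.
  apply: le_lt_trans xr; rewrite -(subrK v0 v) addrC.
  by rewrite (le_trans (ler_normD _ _))// lerD2l distrC.
exists (Q (r / 2)), phi; split.
- split; first exact: oQ.
    by split => //=; rewrite subrr normr0; lra.
  by apply: subset_trans QV; exact: Qsub.
(* On the open set [Q e] the chart formula applies; any other [m] has a neighbourhood that avoids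
   the closed coordinate ball of radius 2r, where [phi] is the identity on its last argument. *)
- move=> a a' m Oa Oa'; have [Qm|nQm] := pselect (Q e m).
    apply: (@near_eq_continuous_at _ _ _
        (fun z => g (psi (f z.1.1, f z.1.2, f z.2)))).
      exists (setT, Q e); first split; first exact: filterT.
        by apply: open_nbhs_nbhs; split; [exact: oQ|exact: Qm].
      by move=> [z m'] [_ /= Qm']; rewrite /phi asboolT.
    have [_ pim] : Q e m /\ (f @` D) (psi (f a, f a', f m)).
      split => //; have [Dg [fg _]] := inim _ (psiQ _ _ _ Oa Oa' Qm.2).
      by exists (g (psi (f a, f a', f m))).
    apply: (@continuous_comp _ _ _
      (fun z : M * M * M => psi (f z.1.1, f z.1.2, f z.2)) g); last first.
      by apply: cg; exact/mem_set.
    apply: (@continuous_comp _ _ _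
      (fun z : M * M * M => (f z.1.1, f z.1.2, f z.2)) psi); last first.
      exact: push_continuous.
    apply: (@continuous_pair_at _ _ _ (fun z : M * M * M => (f z.1.1, f z.1.2))).
      apply: (@continuous_pair_at _ _ _ (fun z : M * M * M => f z.1.1)
          (fun z : M * M * M => f z.1.2)).
        apply: (@continuous_comp _ _ _ (fun z : M * M * M => z.1.1) f).
          by apply: (@continuous_comp _ _ _ fst fst); exact: cvg_fst.
        by apply: cf; apply/mem_set; case: Oa.
      apply: (@continuous_comp _ _ _ (fun z : M * M * M => z.1.2) f).
        by apply: (@continuous_comp _ _ _ fst snd); [exact: cvg_fst|exact: cvg_snd].
      by apply: cf; apply/mem_set; case: Oa'.
    apply: (@continuous_comp _ _ _ snd f); first exact: cvg_snd.
    by apply: cf; apply/mem_set; case: Qm.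
  apply: (@near_eq_continuous_at _ _ _ snd); last exact: cvg_snd.
  exists (setT, ~` (D `&` f @^-1` [set v : 'rV[R]_n | `|v - v0| <= 2 * r])).
    split; first exact: filterT.
    apply: open_nbhs_nbhs; split; first exact: closed_openC.
    move=> /= [Dm mr]; apply: nQm; split => //=.
    by rewrite (le_lt_trans mr)// er; lra.
  move=> [z m'] [_ /= nK]; rewrite /phi /=; case: asboolP => // -[Dm' mr].
  rewrite /psi /push bump_far ?scale0r ?addr0 ?gK//.
  by rewrite leNgt; apply/negP => /ltW mr2; apply: nK.
- move=> a a' Oa Oa'; split.
    have Qa := Qsub _ _ r2e _ Oa.
    rewrite /phi asboolT//= /psi /push bump_near//=; last by have := Oa.2; rewrite /=; lra.
    by rewrite scale1r addrC subrK gK//; case: Oa'.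
  (* [phi] maps [Q e] to itself and fixes its complement, so only two points of [Q e] could collide,
     and [push_inj] excludes that. *)
  move=> m m'; have [Qm|nQm] := pselect (Q e m);
      have [Qm'|nQm'] := pselect (Q e m') => //.
  + have [fm _] := phiQ _ _ _ Oa Oa' Qm; have [fm' _] := phiQ _ _ _ Oa Oa' Qm'.
    move=> /(congr1 f); rewrite fm fm' => /(push_inj r0 (Ow _ _ Oa Oa')) /(congr1 g).
    by rewrite !gK//; [case: Qm'|case: Qm].
  + have [_ Qphi] := phiQ _ _ _ Oa Oa' Qm.
    by rewrite (phiN _ _ m')// => E; rewrite E in Qphi.
  + have [_ Qphi] := phiQ _ _ _ Oa Oa' Qm'.
    by rewrite (phiN _ _ m)// => E; rewrite -E in Qphi.
  + by rewrite !phiN.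
- by move=> a a' m Oa Oa' nV; apply: phiN => /QV.
- move=> a m Oa; rewrite /phi /=; case: asboolP => // -[Dm _].
  by rewrite /psi /push subrr scaler0 addr0 gK.
Qed.

End ChartPush.

Lemma manifold_local_push (R : realType) (n : nat) (M : topologicalType)
    (A : set (@chart R n M)) : smooth_manifold A -> local_push M.
Proof.
move=> [M_hausdorff _ cover _] m0 V oV Vm0; have [c _ cm0] := cover m0.
exact: (chart_push M_hausdorff cm0).
Qed.

(** * From pushing single points to transporting configurations *)

Section ConfTransport.
Context {M : topologicalType}.

Lemma disjoint_nbhs_family (M_hausdorff : hausdorff_space M) (k : nat)
    (y : 'I_k -> M) : injective y ->
  exists V : 'I_k -> set M,
    [/\ forall i, open (V i), forall i, V i (y i)
      & forall i j m, V i m -> V j m -> i = j].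
Proof.
move=> y_inj.
have /choice[Z ZP] : forall ij : 'I_k * 'I_k, exists AB : set M * set M,
    ij.1 != ij.2 -> [/\ nbhs (y ij.1) AB.1, nbhs (y ij.2) AB.2
      & AB.1 `&` AB.2 = set0].
  move=> [i j] /=; have [->|ij] := eqVneq i j; first by exists (set0, set0).
  move: M_hausdorff; rewrite open_hausdorff => /(_ (y i) (y j)).
  case=> [|[S T] /= [/set_mem Sy /set_mem Ty] [oS oT /eqP ST]].
    by apply: contra_neq ij => /y_inj.
  by exists (S, T) => _ /=; split => //; exact: open_nbhs_nbhs.
(* From each separating pair that involves [i], in either order, the side containing [y i]; there
   are finitely many of them. *)
pose V i := [set m | forall j, i != j -> (Z (i, j)).1 m /\ (Z (j, i)).2 m].
have Vn i : nbhs (y i) (V i).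
  suff /filter_forall : forall j, \forall m \near y i,
    i != j -> (Z (i, j)).1 m /\ (Z (j, i)).2 m by [].
  move=> j; have [->|ij] := eqVneq i j; first exact: filterE.
  have ji : j != i by rewrite eq_sym.
  have [Z1 _ _] := ZP (i, j) ij; have [_ Z2 _] := ZP (j, i) ji.
  by apply: filterS (filterI Z1 Z2).
exists (fun i => interior (V i)); split => [i|i|i j m].
- exact: open_interior.
- exact: Vn.
- move=> /interior_subset Vi /interior_subset Vj; apply/eqP/negPn/negP => ij.
  have ji : j != i by rewrite eq_sym.
  have [_ _ Z0] := ZP (i, j) ij.
  by have : set0 m; [rewrite -Z0; split; [exact: (Vi _ ij).1|exact: (Vj _ ji).2]|].
Qed.

Lemma Conf_eq (k : nat) (y z : Conf M k) : Conf_point y =1 Conf_point z -> y = z.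
Proof. by move=> yz; apply: val_inj; apply/funext. Qed.

(** The pushes of the single points are supported in pairwise disjoint sets [V i], so they do not
    disturb each other; each clause then passes to the composite by induction on the list of
    indices. *)
Lemma Conf_push (M_hausdorff : hausdorff_space M) (M_push : local_push M)
    (k : nat) (b0 : Conf M k) :
  exists (U : set (Conf M k)) (T : Conf M k * Conf M k * M -> M),
    [/\ open U /\ U b0,
        forall b b' m, U b -> U b' -> {for (b, b', m), continuous T},
        forall b b', U b -> U b' -> injective (fun m => T (b, b', m)),
        forall b b' i, U b -> U b' -> T (b, b', Conf_point b i) = Conf_point b' i
      & forall b m, U b -> T (b, b, m) = m].
Proof.
have [V [oV Vb Vdisj]] := disjoint_nbhs_family M_hausdorff (@Conf_inj _ _ b0).
have /choice[N NP] := fun i => M_push (Conf_point b0 i) (V i) (oV i) (Vb i).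
have /choice[phi phiP] := NP.
pose U := [set b : Conf M k | forall i, N i (Conf_point b i)].
have oU : open U.
  rewrite openE => b Ub.
  suff /filter_forall : forall i, \forall b' \near b, N i (Conf_point b' i) by [].
  move=> i; apply: (@Conf_point_continuous _ _ i b); apply: open_nbhs_nbhs.
  by split; [have [[]] := phiP i|exact: Ub].
have Ub0 : U b0 by move=> i; have [[]] := phiP i.
have NV i : N i `<=` V i by have [[]] := phiP i.
pose T (s : seq 'I_k) (z : Conf M k * Conf M k * M) : M :=
  foldr (fun i m => phi i (Conf_point z.1.1 i, Conf_point z.1.2 i, m)) z.2 s.
exists U, (T (enum 'I_k)); split.
- by [].
- move=> b b' m Ub Ub'; elim: (enum 'I_k) => [|i s IH].
    by rewrite /T /=; exact: cvg_snd.
  apply: (@continuous_comp _ _ _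
    (fun z => (Conf_point z.1.1 i, Conf_point z.1.2 i, T s z)) (phi i)).
    apply: (@continuous_pair_at _ _ _
      (fun z => (Conf_point z.1.1 i, Conf_point z.1.2 i))); last exact: IH.
    apply: (@continuous_pair_at _ _ _
      (fun z : Conf M k * Conf M k * M => Conf_point z.1.1 i)
      (fun z : Conf M k * Conf M k * M => Conf_point z.1.2 i)).
      apply: (@continuous_comp _ _ _ (fun z : Conf M k * Conf M k * M => z.1.1)
        (fun y => Conf_point y i)); last exact: Conf_point_continuous.
      by apply: (@continuous_comp _ _ _ fst fst); exact: cvg_fst.
    apply: (@continuous_comp _ _ _ (fun z : Conf M k * Conf M k * M => z.1.2)
      (fun y => Conf_point y i)); last exact: Conf_point_continuous.
    by apply: (@continuous_comp _ _ _ fst snd); [exact: cvg_fst|exact: cvg_snd].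
  by have [_ + _ _ _] := phiP i; apply; [exact: Ub|exact: Ub'].
- move=> b b' Ub Ub'; elim: (enum 'I_k) => [|i s IH] // m m' /= e.
  have [_ _ + _ _] := phiP i => /(_ _ _ (Ub i) (Ub' i))[_ phi_inj].
  by apply: IH; apply: phi_inj.
- move=> b b' i Ub Ub'.
  (* The i-th point is at its old or its new position, both in [V i], and is fixed by every push
     with another index. *)
  suff H s : uniq s -> T s (b, b', Conf_point b i) =
      if i \in s then Conf_point b' i else Conf_point b i.
    by rewrite H ?enum_uniq// mem_enum.
  elim: s => [|j s IH] //= /andP[js /IH {}IH].
  rewrite IH inE; have [_ _ phia phiN _] := phiP j.
  have [->|ij] /= := eqVneq i j.
    by rewrite (negbTE js); have [] := phia _ _ (Ub j) (Ub' j).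
  apply: phiN; [exact: Ub|exact: Ub'|move=> Vj].
  have Vi : V i (if i \in s then Conf_point b' i else Conf_point b i).
    by case: ifP => _; apply: NV; [exact: Ub'|exact: Ub].
  by move/eqP: ij; apply; exact: Vdisj Vi Vj.
- move=> b m Ub; elim: (enum 'I_k) => [|i s IH] //=.
  by rewrite IH; have [_ _ _ _] := phiP i; apply; exact: Ub.
Qed.

(** One injection of [M], determined by the first k points and their targets, is applied to all l
    points, which therefore stay distinct. *)
Lemma Conf_proj_local_transport (M_hausdorff : hausdorff_space M)
    (M_push : local_push M) (k l : nat) (kl : (k <= l)%N) :
  local_transport (@Conf_proj M k l kl).
Proof.
move=> b0; have [U [T [[oU Ub0] cT T_inj Tb Tid]]] := Conf_push M_hausdorff M_push b0.
pose p := @Conf_proj M k l kl.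
have cp : continuous p.
  by move=> y; apply: continuous_Conf_at => i; exact: Conf_point_continuous.
pose h (z : Conf M l * Conf M k) (i : 'I_l) := T (p z.1, z.2, Conf_point z.1 i).
(* Injectivity of [h z] is known only over [U]; elsewhere the configuration is returned unchanged as
   a default. *)
pose tau z := match pselect (injective (h z)) with
  | left h_inj => mkConf h_inj
  | right _ => z.1
  end.
have h_inj e b : U (p e) -> U b -> injective (h (e, b)).
  by move=> Ue Ub i j /(T_inj _ _ Ue Ub) /Conf_inj.
have tauE e b i : U (p e) -> U b -> Conf_point (tau (e, b)) i = h (e, b) i.
  by move=> Ue Ub; rewrite /tau; case: pselect => // /(_ (h_inj _ _ Ue Ub)).
exists U, tau; split => //.
- move=> e b Ue Ub; apply: continuous_Conf_at => i.
  apply: (@near_eq_continuous_at _ _ _ (fun z => h z i)).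
    exists (p @^-1` U, U) => /=.
      split; last exact: open_nbhs_nbhs.
      by apply: cp; exact: open_nbhs_nbhs.
    by move=> [e' b'] /= [Ue' Ub']; exact: tauE.
  apply: (@continuous_comp _ _ _
    (fun z : Conf M l * Conf M k => (p z.1, z.2, Conf_point z.1 i)) T).
    apply: (@continuous_pair_at _ _ _ (fun z : Conf M l * Conf M k => (p z.1, z.2))
      (fun z : Conf M l * Conf M k => Conf_point z.1 i)).
      apply: (@continuous_pair_at _ _ _ (p \o fst) snd); last exact: cvg_snd.
      by apply: continuous_comp; [exact: cvg_fst|exact: cp].
    apply: (@continuous_comp _ _ _ fst (fun y : Conf M l => Conf_point y i)).
      exact: cvg_fst.
    exact: Conf_point_continuous.
  exact: cT.
- move=> e b Ue Ub; apply: Conf_eq => i.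
  rewrite [LHS](_ : _ = Conf_point (tau (e, b)) (widen_ord kl i))// tauE//.
  exact: (Tb (p e) b i Ue Ub).
- by move=> e Ue; apply: Conf_eq => i; rewrite tauE//; exact: Tid.
Qed.

End ConfTransport.

(** * Homotopy groups *)

Section UnitInterval.
Context {R : realType}.
Local Notation I := (set_type `[0%R, 1%R : R]).

Lemma unit_proj_subproof (t : R) : clamp 0 1 t \in `[0%R, 1%R : R]%classic.
Proof. by apply/mem_set; rewrite /= in_itv /=; apply: clamp_itv; exact: ler01. Qed.

Definition unit_proj (t : R) : I := SigSub (unit_proj_subproof t).

Lemma unit_proj_continuous : continuous unit_proj.
Proof.
move=> t; apply: continuous_set_type_at.
by apply: (@clamp_continuous _ _ (fun=> 0) (fun=> 1) id);
  [exact: cst_continuous|exact: cvg_cst|exact: cvg_id].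
Qed.

Lemma set_val_unit_continuous : continuous (set_val : I -> R).
Proof. exact: initial_continuous. Qed.

Lemma unit_ge0 (t : I) : 0 <= set_val t.
Proof. by have := set_valP t; rewrite /= in_itv /= => /andP[]. Qed.

Lemma unit_le1 (t : I) : set_val t <= 1.
Proof. by have := set_valP t; rewrite /= in_itv /= => /andP[]. Qed.

Lemma unit_projK (t : I) : unit_proj (set_val t) = t.
Proof. by apply: val_inj; apply: clamp_id; [exact: unit_ge0|exact: unit_le1]. Qed.

Lemma val_unit_proj (t : R) : 0 <= t -> t <= 1 -> set_val (unit_proj t) = t.
Proof. exact: clamp_id. Qed.

Lemma unit_compact : compact [set: I].
Proof.
have -> : [set: I] = unit_proj @` `[0, 1].
  apply/seteqP; split => // t _; exists (set_val t); last exact: unit_projK.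
  exact: set_valP.
apply: continuous_compact; last exact: segment_compact.
by apply: continuous_subspaceT; exact: unit_proj_continuous.
Qed.

Lemma unit_hausdorff : hausdorff_space I.
Proof.
move=> s t st; apply: val_inj.
apply: (@norm_hausdorff R R) => A B As Bt.
have [u [Au Bu]] := st _ _ (set_val_unit_continuous As) (set_val_unit_continuous Bt).
by exists (set_val u).
Qed.

Lemma unit_locally_compact : locally_compact [set: I].
Proof.
move=> t _; exists [set: I]; first by rewrite withinET; exact: filterT.
by split; [exact: unit_compact|exact: closedT].
Qed.

End UnitInterval.

Section Homotopy.
Context {R : realType}.
Local Notation I := (set_type `[0%R, 1%R : R]).

(** Path classes are the case [A = set0] and classes of sphere maps the case of the cube boundary,
    so one equivalence relation serves for both. *)
Definition homotopic_rel {X Y : topologicalType} (A : set X) (a b : X -> Y)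
    : Prop :=
  exists H : X * I -> Y,
    [/\ continuous H,
        forall s t, set_val t = 0 -> H (s, t) = a s,
        forall s t, set_val t = 1 -> H (s, t) = b s
      & forall s t, A s -> H (s, t) = a s].

Section EquivalenceRelation.
Context {X Y : topologicalType} (A : set X).
Implicit Types a b c : X -> Y.

Lemma homotopic_rel_refl a : continuous a -> homotopic_rel A a a.
Proof.
move=> ca; exists (a \o fst); split => // st.
by apply: continuous_comp; [exact: cvg_fst|exact: ca].
Qed.

Lemma homotopic_rel_eq a b s : homotopic_rel A a b -> A s -> b s = a s.
Proof.
move=> [H [_ _ H1 HA]] As.
by rewrite -(H1 s (unit_proj 1)) ?val_unit_proj ?ler01// HA.
Qed.

Lemma homotopic_rel_reparam (H : X * I -> Y) (f : R -> R) : continuous H ->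
  continuous f -> continuous (fun st : X * I => H (st.1, unit_proj (f (set_val st.2)))).
Proof.
move=> cH cf st; apply: (@continuous_comp _ _ _
  (fun st : X * I => (st.1, unit_proj (f (set_val st.2)))) H); last exact: cH.
apply: continuous_pair_at; first exact: cvg_fst.
apply: (@continuous_comp _ _ _ (fun st : X * I => f (set_val st.2)) unit_proj);
  last exact: unit_proj_continuous.
apply: (@continuous_comp _ _ _ (fun st : X * I => set_val st.2) f);
  last exact: cf.
by apply: (@continuous_comp _ _ _ snd set_val);
  [exact: cvg_snd|exact: set_val_unit_continuous].
Qed.

Lemma homotopic_rel_sym a b : homotopic_rel A a b -> homotopic_rel A b a.
Proof.
move=> ab; have eq_A s := @homotopic_rel_eq a b s ab.
case: ab => H [cH H0 H1 HA].
exists (fun st : X * I => H (st.1, unit_proj (1 - set_val st.2))); split.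
- apply: (homotopic_rel_reparam (f := fun t => 1 - t)) => //.
  by move=> t; apply: continuousB; [exact: cst_continuous|exact: cvg_id].
- by move=> s t t0; apply: H1; rewrite /= t0 subr0 val_unit_proj.
- by move=> s t t1; apply: H0; rewrite /= t1 subrr val_unit_proj.
- by move=> s t As /=; rewrite HA// eq_A.
Qed.

Lemma homotopic_rel_trans a b c :
  homotopic_rel A a b -> homotopic_rel A b c -> homotopic_rel A a c.
Proof.
move=> ab; have eq_A s := @homotopic_rel_eq a b s ab.
case: ab => H [cH H0 H1 HA] [K [cK K0 K1 KA]].
exists (fun st : X * I => if set_val st.2 <= 1 / 2
  then H (st.1, unit_proj (2 * set_val st.2))
  else K (st.1, unit_proj (2 * set_val st.2 - 1))); split.
- apply: (@continuous_if_le R _ _ (set_val \o snd) (fun=> 1 / 2)).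
  + by move=> ?; apply: continuous_comp;
      [exact: cvg_snd|exact: set_val_unit_continuous].
  + by move=> ?; exact: cst_continuous.
  + apply: (homotopic_rel_reparam (f := fun t => 2 * t)) => //.
    by move=> t; apply: (@continuousM _ _ (fun=> 2) id t); [exact: cst_continuous|exact: cvg_id].
  + apply: (homotopic_rel_reparam (f := fun t => 2 * t - 1)) => //.
    move=> t; apply: continuousB; last exact: cst_continuous.
    by apply: (@continuousM _ _ (fun=> 2) id t); [exact: cst_continuous|exact: cvg_id].
  + move=> [s t] /= ->; rewrite H1 ?K0// val_unit_proj//; lra.
- move=> s t t0 /=; rewrite t0 ifT; last lra.
  by apply: H0; rewrite mulr0 val_unit_proj.
- move=> s t t1 /=; rewrite t1 ifF; last by apply/negP; lra.
  by apply: K1; rewrite val_unit_proj; lra.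
- by move=> s t As /=; case: ifP => _; [exact: HA|rewrite KA// eq_A].
Qed.

End EquivalenceRelation.

Lemma homotopic_rel_comp (X Y Z : topologicalType) (A : set X) (a b : X -> Y)
    (f : Y -> Z) : continuous f ->
  homotopic_rel A a b -> homotopic_rel A (f \o a) (f \o b).
Proof.
move=> cf [H [cH H0 H1 HA]]; exists (f \o H); split.
- by move=> st; apply: continuous_comp; [exact: cH|exact: cf].
- by move=> s t t0; rewrite /= H0.
- by move=> s t t1; rewrite /= H1.
- by move=> s t As; rewrite /= HA.
Qed.

(** The homotopy is between constant maps on [I], which serves only as a nonempty space: evaluating
    at one point recovers a path. *)
Lemma path_classE (X : topologicalType) (x y : X) :
  path_class R x y <->
  homotopic_rel (set0 : set I) (fun=> x) (fun=> y).
Proof.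
split=> [[g [cg g0 g1]]|[H [cH H0 H1 _]]].
  exists (g \o snd); split; [|by move=> s t /g0|by move=> s t /g1|by []].
  by move=> st; apply: continuous_comp; [exact: cvg_snd|exact: cg].
exists (fun t => H (unit_proj 0, t)); split.
- move=> t; apply: (@continuous_comp _ _ _ (fun t => (unit_proj 0, t)) H).
    by apply: continuous_pair_at; [exact: cst_continuous|exact: cvg_id].
  exact: cH.
- by move=> t; exact: H0.
- by move=> t; exact: H1.
Qed.

Lemma path_class_eq (X : topologicalType) (x y : X) :
  path_class R x y -> path_class R x = path_class R y.
Proof.
move=> /path_classE xy; apply/seteqP; split => z /path_classE h;
  apply/path_classE; apply: homotopic_rel_trans h => //.
exact: homotopic_rel_sym.
Qed.

Lemma path_class_refl (X : topologicalType) (x : X) : path_class R x x.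
Proof. by apply/path_classE; apply: homotopic_rel_refl => ?; exact: cst_continuous. Qed.

(** The union defining [pi0_map] runs over the members of one class, whose images all have the same
    class. *)
Lemma pi0_mapE (X Y : topologicalType) (f : X -> Y) (x : X) : continuous f ->
  pi0_map (R := R) f (path_class R x) = path_class R (f x).
Proof.
move=> cf; apply/seteqP; split => [z [y xy]|z fz].
  have /path_class_eq -> // : path_class R (f x) (f y).
  by apply/path_classE/(homotopic_rel_comp cf)/path_classE.
by exists x => //; exact: path_class_refl.
Qed.

(** That [b] is again a sphere map comes for free: it is the restriction of the homotopy to time 1,
    and the boundary does not move. *)
Lemma sphere_classE (n : nat) (X : topologicalType) (x : X)
    (a b : cube R n -> X) : sphere_map x a ->
  sphere_class x a b <-> homotopic_rel (@cube_boundary R n) a b.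
Proof.
move=> [ca aA]; split=> [[_ [H [cH H0 H1 HA]]]|ab].
  by exists H; split => // s t As; rewrite HA// aA.
have eq_A s := @homotopic_rel_eq _ _ _ a b s ab.
case: ab => H [cH H0 H1 HA]; split; last first.
  by exists H; split => // s t As; rewrite HA// aA.
split; last by move=> s As; rewrite eq_A// aA.
have -> : b = (fun s => H (s, unit_proj 1)).
  by apply/funext => s; rewrite H1// val_unit_proj// ler01.
move=> s; apply: (@continuous_comp _ _ _ (fun s => (s, unit_proj 1)) H).
  by apply: continuous_pair_at; [exact: cvg_id|exact: cst_continuous].
exact: cH.
Qed.

Lemma sphere_class_eq (n : nat) (X : topologicalType) (x : X)
    (a b : cube R n -> X) : sphere_map x a -> sphere_class x a b ->
  sphere_class x a = sphere_class x b.
Proof.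
move=> sa ab; have sb : sphere_map x b by case: ab.
move/(sphere_classE b sa) : ab => ab.
apply/seteqP; split => c /sphere_classE; move=> /(_ ltac:(done)) h;
  apply/sphere_classE => //; apply: homotopic_rel_trans h => //.
exact: homotopic_rel_sym.
Qed.

Lemma sphere_class_refl (n : nat) (X : topologicalType) (x : X)
    (a : cube R n -> X) : sphere_map x a -> sphere_class x a a.
Proof.
by move=> sa; apply/sphere_classE => //; apply: homotopic_rel_refl; case: sa.
Qed.

Lemma sphere_map_comp (n : nat) (X Y : topologicalType) (f : X -> Y) (x : X)
    (a : cube R n -> X) : continuous f ->
  sphere_map x a -> sphere_map (f x) (f \o a).
Proof.
move=> cf [ca aA]; split; last by move=> s /aA /= ->.
by move=> s; apply: continuous_comp; [exact: ca|exact: cf].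
Qed.

Lemma pi_mapE (n : nat) (X Y : topologicalType) (f : X -> Y) (x : X)
    (a : cube R n -> X) : continuous f -> sphere_map x a ->
  pi_map f x (sphere_class x a) = sphere_class (f x) (f \o a).
Proof.
move=> cf sa; have sfa := sphere_map_comp cf sa.
apply/seteqP; split => [c [b ab]|c fc]; last first.
  by exists a => //; exact: sphere_class_refl.
have /sphere_class_eq -> // : sphere_class (f x) (f \o a) (f \o b).
by apply/sphere_classE => //; apply: homotopic_rel_comp => //; apply/(sphere_classE b sa).
Qed.

(** No subspace is fixed in advance: the deformation rests wherever [h] already takes values in the
    image of [j], and there [beta] returns the given preimage. This covers at once the boundary of a
    cube and the ends of a homotopy. *)
Definition compresses (X : topologicalType) {F G : topologicalType}
    (j : F -> G) : Prop :=
  forall h : X -> G, continuous h ->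
  exists (beta : X -> F) (H : X * I -> G),
    [/\ continuous beta, continuous H,
        forall s t, set_val t = 0 -> H (s, t) = h s,
        forall s t, set_val t = 1 -> H (s, t) = j (beta s)
      & forall s f, h s = j f -> beta s = f /\ forall t, H (s, t) = h s].

(** For injectivity, a path or homotopy in [G] between images under [j] is compressed; its ends, and
    its values over the boundary, are images already, so [beta] itself joins the given
    representatives in [F]. For surjectivity, [H] joins a representative to the image of [beta]. *)
Lemma compresses_weak_equivalence (F G : topologicalType) (j : F -> G) :
  continuous j -> compresses I j ->
  (forall n, compresses (cube R n) j) ->
  (forall n, compresses (cube R n * I)%type j) ->
  weak_homotopy_equivalence R j.
Proof.
move=> cj jI jC jCI; split => //.
  split.
  - by move=> _ [x _ <-]; rewrite pi0_mapE//; exists (j x).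
  - move=> _ _ /set_mem [x _ <-] /set_mem [y _ <-]; rewrite !pi0_mapE// => xy.
    have : path_class R (j x) (j y) by rewrite xy; exact: path_class_refl.
    move=> [g [cg g0 g1]]; have [beta [H [cbeta _ _ _ betaE]]] := jI g cg.
    apply: path_class_eq; exists beta; split => // t tE.
      by have [-> _] := betaE t x (g0 t tE).
    by have [-> _] := betaE t y (g1 t tE).
  - move=> _ [z _ <-].
    (* A point is viewed as a constant map on [I]. *)
    have [|beta [H [_ cH H0 H1 _]]] := jI (fun=> z); first by move=> ?; exact: cst_continuous.
    pose t0 : I := unit_proj 0.
    exists (path_class R (beta t0)); first by exists (beta t0).
    rewrite pi0_mapE//; apply/esym/path_class_eq.
    exists (fun t => H (t0, t)); split; [|exact: H0|exact: H1].
    move=> t; apply: (@continuous_comp _ _ _ (fun t => (t0, t)) H).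
      by apply: continuous_pair_at; [exact: cst_continuous|exact: cvg_id].
    exact: cH.
move=> n x; split.
- move=> _ [a sa <-]; rewrite pi_mapE//; exists (j \o a) => //.
  exact: sphere_map_comp.
- move=> _ _ /set_mem [a sa <-] /set_mem [b sb <-]; rewrite !pi_mapE// => ab.
  have : sphere_class (j x) (j \o a) (j \o b).
    by rewrite ab; apply: sphere_class_refl; exact: sphere_map_comp.
  move=> [_ [K [cK K0 K1 KA]]]; have [beta [H [cbeta _ _ _ betaE]]] := jCI _ K cK.
  apply: sphere_class_eq => //; split => //; exists beta; split => // s t st.
  + by have [-> _] := betaE (s, t) _ (K0 s t st).
  + by have [-> _] := betaE (s, t) _ (K1 s t st).
  + by have [-> _] := betaE (s, t) _ (KA s t st).
- move=> _ [c [cc cA] <-].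
  have [beta [H [cbeta cH H0 H1 betaE]]] := jC _ c cc.
  have sbeta : sphere_map x beta.
    by split => // s As; have [-> _] := betaE s x (cA s As).
  exists (sphere_class x beta); first by exists beta.
  rewrite pi_mapE//; apply/esym/sphere_class_eq => //.
  apply/sphere_classE => //; exists H; split => // s t As.
  by have [_ ->] := betaE s x (cA s As).
Qed.

End Homotopy.

(** * The homotopy fibre *)

Section HomotopyFibre.
Context {R : realType}.
Local Notation I := (set_type `[0%R, 1%R : R]).

(** The half of the exponential law that rests on [I] being locally compact and Hausdorff. *)
Lemma unit_uncurry_continuous (X Y : topologicalType)
    (f : X -> {compact-open, I -> Y}) : continuous f ->
  (forall s, continuous (f s : I -> Y)) ->
  continuous (fun st : X * I => f st.1 st.2).
Proof.
move=> cf cfs; have -> : (fun st : X * I => f st.1 st.2) = uncurry f.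
  by apply/funext => -[].
exact: (continuous_uncurry unit_locally_compact unit_hausdorff cf cfs).
Qed.

Lemma unit_curry_continuous (X Y : topologicalType) (f : X * I -> Y) :
  continuous f ->
  continuous ((fun s t => f (s, t)) : X -> {compact-open, I -> Y}).
Proof. exact: continuous_curry_fun. Qed.

(* The lift G of the path gamma issuing from y gives the homotopy
   t |-> (G t, the restriction of gamma to [t, 1]), which ends in the fibre. *)
Lemma hofiber_compress (E B X : topologicalType) (p : E -> B) (b : B)
    (h : X -> hofiber R p b) :
  local_transport p -> compact [set: X] -> @completely_regular_space X ->
  continuous h ->
  exists (beta : X -> E) (H : X * I -> hofiber R p b),
    [/\ continuous beta, continuous H,
        forall s t, set_val t = 0 -> H (s, t) = h s,
        forall s t, set_val t = 1 ->
          p (beta s) = b /\ set_val (H (s, t)) = (beta s, fun=> b)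
      & forall s, (set_val (h s)).2 = (fun=> b) ->
          beta s = (set_val (h s)).1 /\ forall t, H (s, t) = h s].
Proof.
move=> p_tr X_compact X_cr ch.
pose g s := (set_val (h s)).1.
pose w s : {compact-open, I -> B} := (set_val (h s)).2.
have cg : continuous g.
  move=> s; apply: (@continuous_comp _ _ _ (fun s => set_val (h s)) fst);
    last exact: cvg_fst.
  by apply: continuous_comp; [exact: ch|exact: initial_continuous].
have cw : continuous w.
  move=> s; apply: (@continuous_comp _ _ _ (fun s => set_val (h s)) snd);
    last exact: cvg_snd.
  by apply: continuous_comp; [exact: ch|exact: initial_continuous].
have hP s : [/\ continuous (w s : I -> B),
    forall t, set_val t = 0 -> w s t = p (g s)
  & forall t, set_val t = 1 -> w s t = b] by exact: (set_valP (h s)).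
have cws s : continuous (w s : I -> B) by have [] := hP s.
(* The paths are extended to real times by their end values, as the lifting lemmas are stated for
   real times. *)
pose gamma (st : X * R) : B := w st.1 (unit_proj st.2).
have cgamma : continuous gamma.
  move=> st; apply: (@continuous_comp _ _ _
    (fun st : X * R => (st.1, unit_proj st.2)) (fun su : X * I => w su.1 su.2)).
    apply: continuous_pair_at; first exact: cvg_fst.
    by apply: (@continuous_comp _ _ _ snd unit_proj);
      [exact: cvg_snd|exact: unit_proj_continuous].
  exact: unit_uncurry_continuous.
have pg s : p (g s) = gamma (s, 0).
  by have [_ w0 _] := hP s; rewrite /gamma w0//= val_unit_proj// ler01.
have gamma1 s : gamma (s, 1) = b.
  by have [_ _ w1] := hP s; rewrite /gamma w1//= val_unit_proj// ler01.
have gammaE s (t : I) : gamma (s, set_val t) = w s t.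
  by rewrite /gamma /= unit_projK.
have [G [cG G0 pG Greg]] := lifts01 cgamma p_tr X_compact X_cr cg pg.
(* The restriction to [t, 1] is parametrised by all of [I]: the path u |-> gamma (max t u) waits at
   gamma t until u = t. It is the whole path for t = 0 and constant for t = 1. *)
pose tail (su : X * I * I) : B :=
  gamma (su.1.1, Num.max (set_val su.1.2) (set_val su.2)).
have ctail : continuous tail.
  move=> su; apply: (@continuous_comp _ _ _
    (fun su : X * I * I => (su.1.1, Num.max (set_val su.1.2) (set_val su.2)))
    gamma); last exact: cgamma.
  apply: continuous_pair_at.
    by apply: (@continuous_comp _ _ _ fst fst); exact: cvg_fst.
  apply: (@continuous_max _ _ (fun su : X * I * I => set_val su.1.2)
    (fun su : X * I * I => set_val su.2)).
    apply: (@continuous_comp _ _ _ (fun su : X * I * I => su.1.2) set_val);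
      last exact: set_val_unit_continuous.
    by apply: (@continuous_comp _ _ _ fst snd); [exact: cvg_fst|exact: cvg_snd].
  by apply: (@continuous_comp _ _ _ snd set_val);
    [exact: cvg_snd|exact: set_val_unit_continuous].
pose K (st : X * I) : E * {compact-open, I -> B} :=
  (G (st.1, set_val st.2), fun u => tail (st, u)).
have KP st : K st \in hofiber_set p b.
  case: st => s t; apply/mem_set; split => /=.
  - move=> u; apply: (@continuous_comp _ _ _ (fun u => (s, t, u)) tail).
      by apply: continuous_pair_at; [exact: cst_continuous|exact: cvg_id].
    exact: ctail.
  - move=> u u0; rewrite /tail /= u0 max_l ?unit_ge0// pG//.
      exact: unit_ge0.
    exact: unit_le1.
  - by move=> u u1; rewrite /tail /= u1 max_r ?unit_le1.
exists (fun s => G (s, 1)), (fun st => SigSub (KP st)); split.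
- move=> s; apply: (@continuous_comp _ _ _ (fun s => (s, 1 : R)) G); last exact: cG.
  by apply: continuous_pair_at; [exact: cvg_id|exact: cst_continuous].
- move=> st; apply: continuous_set_type_at.
  apply: (@continuous_pair_at _ _ _ (fun st : X * I => G (st.1, set_val st.2))
    ((fun st u => tail (st, u)) : X * I -> {compact-open, I -> B})).
    apply: (@continuous_comp _ _ _ (fun st : X * I => (st.1, set_val st.2)) G);
      last exact: cG.
    apply: continuous_pair_at; first exact: cvg_fst.
    by apply: (@continuous_comp _ _ _ snd set_val);
      [exact: cvg_snd|exact: set_val_unit_continuous].
  exact: unit_curry_continuous.
- move=> s t t0; apply: val_inj; rewrite /= /K /= t0 G0.
  rewrite [RHS]surjective_pairing; congr pair; apply/funext => u.
  by rewrite /tail /= t0 max_r ?unit_ge0.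
- move=> s t t1; split; first by rewrite pG ?ler01.
  rewrite -[LHS]/(K (s, t)) /K /= t1; congr pair; apply/funext => u.
  by rewrite /tail /= t1 max_l ?unit_le1.
- move=> s ws.
  have gammab t : gamma (s, t) = b by rewrite /gamma /w /= ws.
  have Gs t : G (s, t) = g s by apply: Greg => t'; rewrite !gammab.
  split; first exact: Gs.
  move=> t; apply: val_inj; rewrite /= /K /= Gs.
  rewrite [RHS]surjective_pairing ws; congr pair; apply/funext => u.
  exact: gammab.
Qed.

Lemma cube_compact (n : nat) : compact [set: cube R n].
Proof.
have := @tychonoff 'I_n (fun=> I) (fun=> setT) (fun=> unit_compact).
by rewrite [X in compact X -> _](_ : _ = setT)//; apply/seteqP; split.
Qed.

End HomotopyFibre.

(** * The strict fibre of the projection of configuration spaces *)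

Section Fibre.
Context {M : topologicalType} {k l : nat} (kl : (k <= l)%N) (x : Conf M k).

Lemma Conf_proj_continuous : continuous (@Conf_proj M k l kl).
Proof. by move=> y; apply: continuous_Conf_at => i; exact: Conf_point_continuous. Qed.

Lemma fiber_incl_widen (z : Conf (punctured x) (l - k)) (i : 'I_k) :
  Conf_point (fiber_incl kl x z) (widen_ord kl i) = Conf_point x i.
Proof.
rewrite [LHS]/(fiber_incl_fun kl z (widen_ord kl i)) /fiber_incl_fun.
have -> : cast_ord (esym (subnKC kl)) (widen_ord kl i) = lshift (l - k) i.
  exact: val_inj.
by rewrite -[lshift _ _]/(unsplit (inl i)) unsplitK.
Qed.

Definition free_index (i : 'I_(l - k)) : 'I_l :=
  cast_ord (subnKC kl) (rshift k i).

Lemma fiber_incl_free (z : Conf (punctured x) (l - k)) (i : 'I_(l - k)) :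
  Conf_point (fiber_incl kl x z) (free_index i) = set_val (Conf_point z i).
Proof.
rewrite [LHS]/(fiber_incl_fun kl z (free_index i)) /fiber_incl_fun /free_index.
by rewrite cast_ordK -[rshift _ _]/(unsplit (inr i)) unsplitK.
Qed.

Lemma Conf_index_cases (i : 'I_l) :
  (exists j, i = widen_ord kl j) \/ (exists j, i = free_index j).
Proof.
have [ik|ki] := ltnP i k; first by left; exists (Ordinal ik); exact: val_inj.
right; have ikl : (i - k < l - k)%N by rewrite ltn_sub2r// (leq_ltn_trans ki).
by exists (Ordinal ikl); apply: val_inj; rewrite /= subnKC.
Qed.

Lemma fiber_incl_proj (z : Conf (punctured x) (l - k)) :
  Conf_proj kl (fiber_incl kl x z) = x.
Proof. by apply: Conf_eq => i; exact: fiber_incl_widen. Qed.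

Lemma fiber_incl_continuous : continuous (fiber_incl kl x).
Proof.
move=> z; apply: continuous_Conf_at => i.
have [[j ->]|[j ->]] := Conf_index_cases i.
  apply: (@eq_continuous_at _ _ _ (fun=> Conf_point x j)).
    by move=> z'; exact: fiber_incl_widen.
  exact: cst_continuous.
apply: (@eq_continuous_at _ _ _ (fun z => set_val (Conf_point z j))).
  by move=> z'; exact: fiber_incl_free.
apply: (@continuous_comp _ _ _ (fun z => Conf_point z j) set_val).
  exact: Conf_point_continuous.
exact: initial_continuous.
Qed.

Lemma fiber_incl_inj : injective (fiber_incl kl x).
Proof.
move=> y z yz; apply: Conf_eq => i; apply: val_inj.
by rewrite -[val _]fiber_incl_free yz fiber_incl_free.
Qed.

Section FibrePoint.
Variables (e : Conf M l) (pe : Conf_proj kl e = x).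

Lemma free_coordinate_subproof (i : 'I_(l - k)) :
  Conf_point e (free_index i) \in ~` range (Conf_point x).
Proof.
apply/mem_set => -[j _]; rewrite -pe => e_ij.
have /(congr1 val) /= ij := @Conf_inj _ _ e (widen_ord kl j) (free_index i) e_ij.
by have := ltn_ord j; rewrite ij ltnNge leq_addr.
Qed.

Lemma free_coordinates_inj :
  injective (fun i => SigSub (free_coordinate_subproof i) : punctured x).
Proof.
move=> i j /(congr1 val) /= e_ij.
have /(congr1 val) /= /addnI := @Conf_inj _ _ e _ _ e_ij; exact: val_inj.
Qed.

Definition fiber_point : Conf (punctured x) (l - k) := mkConf free_coordinates_inj.

Lemma fiber_pointK : fiber_incl kl x fiber_point = e.
Proof.
apply: Conf_eq => i; have [[j ->]|[j ->]] := Conf_index_cases i.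
  by rewrite fiber_incl_widen -pe.
by rewrite fiber_incl_free.
Qed.

End FibrePoint.

(** The coordinates of [fiber_point] are coordinates of [f s], and the subspace and product
    topologies are initial. So [fiber_incl] is a homeomorphism onto the strict fibre. *)
Lemma fiber_point_continuous (X : topologicalType) (f : X -> Conf M l)
    (pf : forall s, Conf_proj kl (f s) = x) :
  continuous f -> continuous (fun s => fiber_point (pf s)).
Proof.
move=> cf s; apply: continuous_Conf_at => i; apply: continuous_set_type_at.
apply: (@continuous_comp _ _ _ f (fun y => Conf_point y (free_index i))).
  exact: cf.
exact: Conf_point_continuous.
Qed.

End Fibre.

(** * Compressing the homotopy fibre into the fibre *)

Section FibreCompress.
Context {R : realType} {M : topologicalType} {k l : nat}.
Local Notation I := (set_type `[0%R, 1%R : R]).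
Variables (kl : (k <= l)%N) (x : Conf M k).
Hypothesis p_transport : local_transport (@Conf_proj M k l kl).
Variables (bottom_cont : continuous (set_val : [set x] -> Conf M k))
  (commutes : forall z, set_val (fiber_base l x z) =
                        Conf_proj kl (fiber_incl kl x z)).

(** The base of the left-hand map is a point, so its homotopy fibre consists of pairs of a point and
    a constant path. These correspond to the pairs in which the deformation of [hofiber_compress]
    ends. *)
Lemma fibre_compresses (b : [set x]) (X : topologicalType) :
  compact [set: X] -> @completely_regular_space X ->
  compresses (R := R) X (hofiber_map (R := R) bottom_cont commutes (b := b)).
Proof.
move=> X_compact X_cr h ch.
have bx : set_val b = x by exact: (set_valP b).
have [beta [H [cbeta cH H0 H1 HE]]] :=
  hofiber_compress p_transport X_compact X_cr ch.
have pbeta s : Conf_proj kl (beta s) = x.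
  have [-> _ //] := H1 s (unit_proj 1) (val_unit_proj (@ler01 R) (lexx _)).
have b_unique (b' : [set x]) : b' = b.
  apply: val_inj; transitivity x; first exact: (set_valP b').
  exact/esym/(set_valP b).
pose z s : Conf (punctured x) (l - k) * {compact-open, I -> [set x]} :=
  (fiber_point (pbeta s), fun=> b).
have zP s : z s \in hofiber_set (R := R) (fiber_base l x) b.
  apply/mem_set; split; [exact: cst_continuous| |by []].
  by move=> t _; rewrite [RHS]b_unique.
exists (fun s => SigSub (zP s)), H; split => //.
- move=> s; apply: continuous_set_type_at.
  apply: continuous_pair_at; last exact: cst_continuous.
  exact: fiber_point_continuous.
- move=> s t t1; have [_ HE1] := H1 s t t1; apply: val_inj.
  by rewrite /= [LHS]HE1 /= fiber_pointK.
- move=> s f hf.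
  (* A path in [[set x]] is constant, so its image is a constant path, and the stationarity clause
     of [hofiber_compress] applies. *)
  have hsE : set_val (h s) = (fiber_incl kl x (set_val f).1, fun=> set_val b).
    rewrite hf /=; congr pair; apply/funext => t /=.
    by congr set_val; exact: b_unique.
  have [|bs Hs] := HE s; first by rewrite hsE.
  split => //; apply: val_inj => /=.
  rewrite [RHS]surjective_pairing; congr pair.
    by apply: (@fiber_incl_inj M k l kl x); rewrite fiber_pointK bs hsE.
  by apply/funext => t; apply/esym/b_unique.
Qed.

(** All paths in [[set x]] have the same image, so the path component of the map is constant. *)
Lemma fibre_map_continuous (b : [set x]) :
  continuous (hofiber_map (R := R) bottom_cont commutes (b := b)).
Proof.
move=> z; apply: continuous_set_type_at.
apply: (@eq_continuous_at _ _ _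
    (fun z : hofiber R (fiber_base l x) b =>
      (fiber_incl kl x (set_val z).1, fun=> x)
      : Conf M l * {compact-open, I -> Conf M k})).
  move=> z' /=; congr pair; apply/funext => t /=.
  exact: (set_valP ((set_val z').2 t)).
apply: continuous_pair_at; last exact: cst_continuous.
apply: (@continuous_comp _ _ _
  (fun z : hofiber R (fiber_base l x) b => (set_val z).1) (fiber_incl kl x));
  last exact: fiber_incl_continuous.
apply: (@continuous_comp _ _ _ set_val fst); last exact: cvg_fst.
exact: initial_continuous.
Qed.

End FibreCompress.

Theorem theorem2p3p2 (R : realType) (n : nat) (M : topologicalType)
    (A : set (@chart R n M)) (M_manifold : smooth_manifold A)
    (M_finite_type : finite_type A)
    (k l : nat) (kl : (k <= l)%N) (x : Conf M k) :
  homotopy_cartesian R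
    (fiber_incl kl x : Conf (punctured x) (l - k) -> Conf M l)
    (fiber_base l x : Conf (punctured x) (l - k) -> [set x])
    (Conf_proj kl : Conf M l -> Conf M k)
    (set_val : [set x] -> Conf M k).
Proof.
have p_transport := Conf_proj_local_transport (manifold_hausdorff M_manifold)
  (manifold_local_push M_manifold) kl.
have bottom_cont : continuous (set_val : [set x] -> Conf M k).
  exact: initial_continuous.
have commutes z : set_val (fiber_base l x z) = Conf_proj kl (fiber_incl kl x z).
  by rewrite fiber_incl_proj.
split.
- exact: fiber_incl_continuous.
- exact: cst_continuous.
- exact: Conf_proj_continuous.
exists bottom_cont, commutes => b; apply: compresses_weak_equivalence.
- exact: fibre_map_continuous.
- apply: fibre_compresses => //; first exact: unit_compact.
  exact: (@uniform_completely_regular R).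
- move=> m; apply: fibre_compresses => //; first exact: cube_compact.
  (* Complete regularity comes from a uniform structure; [cube] is declared only as a topological
     space, so its product form is given explicitly. *)
  exact: (@uniform_completely_regular R {ptws 'I_m -> _}).
- move=> m; apply: fibre_compresses => //.
    rewrite -setXTT; apply: compact_setX; [exact: cube_compact|exact: unit_compact].
  exact: (@uniform_completely_regular R ({ptws 'I_m -> _} * _)%type).
Qed.
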